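(* For any instance of $\mathrm{Max}\text{-}r\text{-}\mathrm{SAT}$ with $n$ variables, one can compute a $0.618$-approximate optimal assignment (an assignment satisfying at least $0.618$ times the maximum number of simultaneously satisfiable clauses) by a deterministic algorithm in the read-only-input, write-only-output model that runs in time $n^{O(1)}$ and uses $O(\log n)$ bits of auxiliary space.
   Context: An instance of $\mathrm{Max}\text{-}r\text{-}\mathrm{SAT}$ is a CNF formula $F = C_1 \wedge \dots \wedge C_m$ over variables $x_1,\dots,x_n$, where each clause $C_j$ is a disjunction of at most $r$ literals (variables or their negations). An assignment is a map from $\{x_1,\dots,x_n\}$ to $\{0,1\}$; the goal is to satisfy as many clauses as possible. Model of computation: a RAM in which the input formula is given in a canonical representation with read-only (random) access, the algorithm has read-write access to auxiliary memory whose size is measured in bits, and the output is written to a write-only stream that cannot be read back. Space bounds refer to the number of auxiliary bits used.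
   Formalization: The number of clauses is assumed to be at most (n+2)^d for a fixed but arbitrary d (automatic for distinct clauses with r fixed); with unboundedly many repeated clauses no algorithm can run in time n^O(1). *)

(* Defs.v *)
From mathcomp Require Import all_boot all_order all_algebra.

Set Implicit Arguments.
Unset Strict Implicit.
Unset Printing Implicit Defensive.

Import GRing.Theory Num.Theory.

(* [(i, true)] is the variable x_i and [(i, false)] is its negation. *)
Definition literal (n : nat) : Type := ('I_n * bool)%type.
Definition clause (n : nat) : Type := seq (literal n).
Definition formula (n : nat) : Type := seq (clause n).
Definition assignment (n : nat) : Type := {ffun 'I_n -> bool}.

Definition max_rsat_instance (r n : nat) (F : formula n) : bool :=
  all (fun C : clause n => size C <= r) F.

Definition sat_clause n (a : assignment n) (C : clause n) : bool :=
  has (fun l : literal n => a l.1 == l.2) C.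

Definition num_sat n (F : formula n) (a : assignment n) : nat :=
  count (sat_clause a) F.

Definition max_sat n (F : formula n) : nat :=
  \max_(a : {ffun 'I_n -> bool}) num_sat F a.

Definition approx_optimal (rho : rat) n (F : formula n) (a : assignment n) :=
  (rho * (max_sat F)%:R <= (num_sat F a)%:R)%R.

(* A formula without repeated clauses has polynomially many of them; this is
   what makes a time bound depending on n alone meaningful, since a formula
   given with unboundedly many copies of a clause cannot even be read in time
   n^O(1). *)
Lemma size_uniq_instance (r n : nat) (F : formula n) :
  max_rsat_instance r F -> uniq F -> size F <= (n + 2) ^ (2 * r).
Proof.
move=> /allP rF uF.
pose f (C : clause n) : r.-tuple (option ('I_n * bool)) :=
  [tuple onth C i | i < r].
have inj_f : {in F &, injective f}.
  move=> C D CF DF eqf; have [sC sD] := (rF _ CF, rF _ DF).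
  apply/eq_from_onth => i; case: (ltnP i r) => [ltir | leri].
    by have := congr1 (fun t => tnth t (Ordinal ltir)) eqf; rewrite !tnth_mktuple.
  by rewrite !onth_default ?(leq_trans sC) ?(leq_trans sD).
rewrite -(size_map f) -(card_uniqP _) ?map_inj_in_uniq //.
apply: leq_trans (max_card _) _.
rewrite card_tuple card_option card_prod card_ord card_bool expnM.
case: r {rF f inj_f} => [|r] //; rewrite leq_exp2r // sqrnD -add1n leq_add //.
  by rewrite addn_gt0 orbT.
by rewrite leq_pmull.
Qed.

Variant arith := Add | Sub | Mul | Div | Mod.

(* [a], [b], [c] are memory addresses, [k] is an immediate constant and [l] a
   program location; [Fetch] and [Store] use indirect addressing. *)
Variant instr :=
| Const (a k : nat)
| Arith (o : arith) (a b c : nat)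
| Fetch (a b : nat)
| Store (a b : nat)
| Read (a b : nat)
| Write (a : nat)
| Jump (l : nat)
| Jumpz (a l : nat).

Definition program := seq instr.

Record config := Config {
  pc : nat;
  mem : nat -> nat;
  out : seq bool
}.

(* Subtraction is truncated; m %/ 0 = 0 and m %% 0 = m. *)
Definition eval_arith (o : arith) : nat -> nat -> nat :=
  match o with
  | Add => addn | Sub => subn | Mul => muln | Div => divn | Mod => modn
  end.

Definition upd (M : nat -> nat) (a v : nat) : nat -> nat :=
  fun x => if x == a then v else M x.

Definition exec (input : seq nat) (i : instr) (s : config) : config :=
  let: Config p M o := s in
  match i with
  | Const a k => Config p.+1 (upd M a k) o
  | Arith f a b c => Config p.+1 (upd M a (eval_arith f (M b) (M c))) o
  | Fetch a b => Config p.+1 (upd M a (M (M b))) o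
  | Store a b => Config p.+1 (upd M (M a) (M b)) o
  | Read a b => Config p.+1 (upd M a (nth 0 input (M b))) o
  | Write a => Config p.+1 M (rcons o (M a != 0))
  | Jump l => Config l M o
  | Jumpz a l => Config (if M a == 0 then l else p.+1) M o
  end.

Definition halted (P : program) (s : config) : bool := size P <= pc s.

Definition step (P : program) (input : seq nat) (s : config) : config :=
  if onth P (pc s) is Some i then exec input i s else s.

Definition run (P : program) (input : seq nat) (t : nat) : config :=
  iter t (step P input) (Config 0 (fun=> 0) [::]).

(* The whole memory contents is recorded by K words of w bits each: the cells
   from address K on hold their initial value 0. *)
Definition fits (K w : nat) (M : nat -> nat) : Prop :=
  forall x, if x < K then M x < 2 ^ w else M x == 0.

(* [P] halts on [input] after at most [T] steps with output [o], using an
   auxiliary memory of at most [S] bits throughout. Since words have at most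
   [S] bits, charging one time unit per arithmetic instruction is harmless for
   polynomial time bounds when [S] is logarithmic. *)
Definition computes (P : program) (input : seq nat) (T S : nat)
    (o : seq bool) : Prop :=
  exists t K w : nat,
    [/\ t <= T, halted P (run P input t), out (run P input t) = o,
        K * w <= S & forall i, i <= t -> fits K w (mem (run P input i))].

Definition encode_literal n (l : literal n) : nat := 2 * l.1 + l.2.

Definition encode_clause n (C : clause n) : seq nat :=
  size C :: map (@encode_literal n) C.

Definition encode n (F : formula n) : seq nat :=
  n :: size F :: flatten (map (@encode_clause n) F).

Definition encode_assignment n (a : assignment n) : seq bool :=
  [seq a i | i <- enum 'I_n].

(* Main.v *)
(* Let p = 618/1000, and for each variable let its preferred value be the one
   satisfied by more of the clauses that consist of copies of a single literal.
   Give every variable its preferred value with probability p, pairwise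
   independently. A clause with two distinct literals fails with probability at
   most p^2 <= 1 - p (p is just below the golden ratio conjugate), and of the two
   opposite groups of one-literal clauses on a variable, which no assignment
   satisfies together, the larger one is satisfied with probability p. Hence the
   expected number of satisfied clauses is at least p times the optimum.

   Pairwise independence holds when x_i is decided by the value modulo 1000 of
   the sum of the seed digits s_t (in base 1000) over the positions t where the
   binary expansion of 2i+1 has a 1. There are polynomially many seeds, and a
   machine with a constant number of registers can try them all, keep the best
   one, and recompute its bits one by one for the output. The program is written
   in a small language of assignments and counting loops that compiles to the
   RAM; if its variables stay below b, its time and its memory words stay below
   fixed powers of b. *)
Require Import Defs.
From mathcomp Require Import all_boot all_order all_algebra.
From mathcomp Require Import zify.

Set Implicit Arguments.
Unset Strict Implicit.
Unset Printing Implicit Defensive.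

Import GRing.Theory Num.Theory.

(** * A loop language and its compilation to the RAM *)

Inductive expr :=
| Lit (k : nat)
| Var (x : nat)
| Op (o : arith) (e1 e2 : expr)
| Inp (e : expr).

Inductive cmd :=
| Asg (x : nat) (e : expr)
| Out (x : nat)
| Seq (c1 c2 : cmd)
| Loop (x : nat) (c : cmd).

Fixpoint eval (input : seq nat) (v : seq nat) (e : expr) : nat :=
  match e with
  | Lit k => k
  | Var x => nth 0 v x
  | Op o e1 e2 => eval_arith o (eval input v e1) (eval input v e2)
  | Inp e => nth 0 input (eval input v e)
  end.

Definition state := (seq nat * seq bool)%type.

Definition decr (x : nat) (s : state) : state :=
  (set_nth 0 s.1 x (nth 0 s.1 x - 1), s.2).

(* The bound [b] is required of the values of variables only, not of the
   intermediate values of expressions. *)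
Fixpoint runs (input : seq nat) (b : nat) (c : cmd) (s s' : state) : Prop :=
  match c with
  | Asg x e =>
      eval input s.1 e <= b /\ s' = (set_nth 0 s.1 x (eval input s.1 e), s.2)
  | Out x => s' = (s.1, rcons s.2 (nth 0 s.1 x != 0))
  | Seq c1 c2 => exists s1, runs input b c1 s s1 /\ runs input b c2 s1 s'
  | Loop x c => exists (k : nat) (f : nat -> state),
      [/\ f 0 = s, f k = s', forall i, i <= k -> nth 0 (f i).1 x = k - i &
          forall i, i < k ->
            exists s1, runs input b c (f i) s1 /\ f i.+1 = decr x s1]
  end.

Fixpoint wf_expr (V : nat) (e : expr) : bool :=
  match e with
  | Lit _ => true
  | Var x => x < V
  | Op _ e1 e2 => wf_expr V e1 && wf_expr V e2
  | Inp e => wf_expr V e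
  end.

Fixpoint wf_cmd (V : nat) (c : cmd) : bool :=
  match c with
  | Asg x e => (x < V) && wf_expr V e
  | Out x => x < V
  | Seq c1 c2 => wf_cmd V c1 && wf_cmd V c2
  | Loop x c => (x < V) && wf_cmd V c
  end.

(** The scratch cells from [t] on serve as an evaluation stack. There is no move instruction, so a
    variable is copied by adding it to a cell that holds 0. *)
Fixpoint code_expr (t : nat) (e : expr) : program :=
  match e with
  | Lit k => [:: Const t k]
  | Var x => [:: Const t 0; Arith Add t x t]
  | Op o e1 e2 => code_expr t e1 ++ code_expr t.+1 e2 ++ [:: Arith o t t t.+1]
  | Inp e => code_expr t e ++ [:: Read t t]
  end.

(** Jumps are absolute, so the length of a loop body must be known before its code is produced. *)
Fixpoint size_code (c : cmd) : nat :=
  match c with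
  | Asg x e => size (code_expr 0 e) + 2
  | Out _ => 1
  | Seq c1 c2 => size_code c1 + size_code c2
  | Loop _ c => size_code c + 4
  end.

(* Variables live in the cells below [V]; the cells from [V] on are scratch. *)
Fixpoint code_cmd (V p : nat) (c : cmd) : program :=
  match c with
  | Asg x e => code_expr V e ++ [:: Const V.+1 0; Arith Add x V V.+1]
  | Out x => [:: Write x]
  | Seq c1 c2 => code_cmd V p c1 ++ code_cmd V (p + size_code c1) c2
  | Loop x c =>
      Jumpz x (p + (size_code c + 4)) :: code_cmd V p.+1 c ++
      [:: Const V 1; Arith Defs.Sub x x V; Jump p]
  end.

(* For b >= 2, the value of [e] and of its subexpressions is at most
   [b ^ degree e] when variables and input words are at most [b]; the degree
   also bounds the number of scratch cells used. *)
Fixpoint degree (e : expr) : nat :=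
  match e with
  | Lit k => k.+1
  | Var _ => 2
  | Op _ e1 e2 => degree e1 + degree e2
  | Inp e => (degree e).+1
  end.

Fixpoint degree_cmd (c : cmd) : nat :=
  match c with
  | Asg _ e => degree e
  | Out _ => 0
  | Seq c1 c2 => degree_cmd c1 + degree_cmd c2
  | Loop _ c => degree_cmd c
  end.

(** A loop counter is a variable, hence there are at most [b] rounds; each adds four instructions
    for test, decrement and jump, and the last test adds one. *)
Fixpoint time_cmd (b : nat) (c : cmd) : nat :=
  match c with
  | Asg x e => size (code_expr 0 e) + 2
  | Out _ => 1
  | Seq c1 c2 => time_cmd b c1 + time_cmd b c2
  | Loop _ c => b * (time_cmd b c + 4) + 1
  end.

Lemma size_code_expr t t' e : size (code_expr t e) = size (code_expr t' e).
Proof.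
by elim: e t t' => //= [o e1 IH1 e2 IH2 | e IH] t t';
  rewrite !size_cat ?(IH1 t t') ?(IH2 t.+1 t'.+1) ?(IH t t').
Qed.

Lemma size_code_cmd V p c : size (code_cmd V p c) = size_code c.
Proof.
elim: c p => //= [x e | c1 IH1 c2 IH2 | x c IH] p; rewrite /= ?size_cat /=.
- by rewrite (size_code_expr V 0).
- by rewrite IH1 IH2.
- by rewrite IH -addnS.
Qed.

Lemma time_cmd_poly c : exists e, forall b, 2 <= b -> time_cmd b c <= b ^ e.
Proof.
elim: c => [x e | x | c1 [e1 H1] c2 [e2 H2] | x c [e H]] /=.
- exists (size (code_expr 0 e) + 2) => b b2.
  exact: ltnW (ltn_expl _ b2).
- by exists 0.
- exists (e1 + e2).+1 => b b2.
  have b0 : 0 < b by apply: leq_trans b2.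
  rewrite expnS expnD.
  have u0 : 0 < b ^ e1 by rewrite expn_gt0 b0.
  have v0 : 0 < b ^ e2 by rewrite expn_gt0 b0.
  apply: leq_trans (leq_add (H1 b b2) (H2 b b2)) _.
  apply: leq_trans (leq_mul b2 (leqnn _)).
  move: (b ^ e1) (b ^ e2) u0 v0 => [|u] [|v] //; nia.
- exists (e + 5) => b b2; move: (H b b2) => {}H.
  have b0 : 0 < b by apply: leq_trans b2.
  have E0 : 0 < b ^ e by rewrite expn_gt0 b0.
  have B4 : 16 <= b ^ 4 by rewrite (@leq_exp2r 2 b 4).
  rewrite expnD (expnS b 4).
  move: (b ^ e) (b ^ 4) (time_cmd b c) E0 B4 H => u v t u0 v16 tu.
  apply: (@leq_trans (u * (b * 6))); first by nia.
  by rewrite !leq_mul // (leq_trans _ v16).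
Qed.

(** * Simulation of the loop language by the machine *)

Section Machine.

Variables (P : program) (input : seq nat) (K w : nat).

Definition reach (T : nat) (s s' : config) : Prop :=
  exists t, [/\ t <= T, iter t (step P input) s = s' &
    forall i, i <= t -> fits K w (Defs.mem (iter i (step P input) s))].

Lemma reach_trans T1 T2 s1 s2 s3 :
  reach T1 s1 s2 -> reach T2 s2 s3 -> reach (T1 + T2) s1 s3.
Proof.
case=> t1 [le1 e1 f1] [t2 [le2 e2 f2]]; exists (t2 + t1); split.
- by rewrite addnC leq_add.
- by rewrite iterD e1.
- move=> i lei; case: (leqP i t1) => [/f1 // | lti].
  rewrite -(subnK (ltnW lti)) iterD e1; apply: f2.
  by rewrite leq_subLR addnC.
Qed.

Lemma reach_leq T1 T2 s1 s2 : T1 <= T2 -> reach T1 s1 s2 -> reach T2 s1 s2.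
Proof. by move=> le12 [t [le1 e1 f1]]; exists t; split=> //; apply: leq_trans le12. Qed.

Lemma reach_refl s : fits K w (Defs.mem s) -> reach 0 s s.
Proof. by move=> fs; exists 0; split=> // i; rewrite leqn0 => /eqP->. Qed.

Lemma reach_fits T s s' : reach T s s' -> fits K w (Defs.mem s').
Proof. by case=> t [_ <- f]; apply: f. Qed.

Lemma upd_eq M x k : upd M x k x = k.
Proof. by rewrite /upd eqxx. Qed.

Lemma upd_ltn M x y k : y < x -> upd M x k y = M y.
Proof. by move=> yx; rewrite /upd ltn_eqF. Qed.

Lemma fits_upd M x k : fits K w M -> x < K -> k < 2 ^ w -> fits K w (upd M x k).
Proof.
move=> fM xK kw y; rewrite /upd; case: eqP => [-> | _]; last exact: fM.
by rewrite xK.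
Qed.

Definition loaded (p : nat) (Q : program) : Prop :=
  exists Q1 Q2, P = Q1 ++ Q ++ Q2 /\ p = size Q1.

Lemma loaded_cat p Q1 Q2 :
  loaded p (Q1 ++ Q2) -> loaded p Q1 /\ loaded (p + size Q1) Q2.
Proof.
case=> R1 [R2 [eP ->]]; split; first by exists R1, (Q2 ++ R2); rewrite eP -!catA.
by exists (R1 ++ Q1), R2; rewrite eP -!catA size_cat.
Qed.

Lemma loaded_cons p i Q : loaded p (i :: Q) -> loaded p [:: i] /\ loaded p.+1 Q.
Proof. by rewrite -cat1s => /loaded_cat; rewrite addn1. Qed.

Lemma reach_instr p i M o :
  loaded p [:: i] -> fits K w M ->
  fits K w (Defs.mem (exec input i (Config p M o))) ->
  reach 1 (Config p M o) (exec input i (Config p M o)).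
Proof.
case=> Q1 [Q2 [eP ep]] fM fM'.
have es : step P input (Config p M o) = exec input i (Config p M o).
  by rewrite /step /= eP ep onth_cat ltnn subnn.
exists 1; split=> //; case=> [|[|]] //= _; by rewrite es.
Qed.

Variables (b D V : nat).
Hypotheses (b2 : 2 <= b) (inputb : forall x, nth 0 input x <= b).
Hypotheses (bD : b ^ D < 2 ^ w) (VK : V + D + 2 <= K) (D2 : 2 <= D).

Definition agree (M : nat -> nat) (v : seq nat) : Prop :=
  forall x, x < V -> M x = nth 0 v x.

Definition bounded (v : seq nat) : Prop := forall x, nth 0 v x <= b.

Lemma degree_gt0 e : 0 < degree e.
Proof. by elim: e => //= o e1 IH1 e2 IH2; rewrite addn_gt0 IH1. Qed.

Lemma eval_leq v e : bounded v -> eval input v e <= b ^ degree e.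
Proof.
have b0 : 0 < b by apply: leq_trans b2.
move=> bv; elim: e => /= [k | x | o e1 IH1 e2 IH2 | e IH].
- exact: ltnW (ltnW (ltn_expl _ b2)).
- by apply: leq_trans (bv x) _; rewrite -{1}(expn1 b) leq_exp2l.
(* Both powers are at least 2, so a sum is bounded by their product; difference, quotient and
   remainder never exceed the first operand. *)
- have U1 : b <= b ^ degree e1 by rewrite -{1}(expn1 b) leq_exp2l // degree_gt0.
  have U2 : b <= b ^ degree e2 by rewrite -{1}(expn1 b) leq_exp2l // degree_gt0.
  rewrite expnD; case: o => /=.
  + by move: U1 U2 IH1 IH2 b2; move: (b ^ _) (b ^ _) => u1 u2; nia.
  + by apply: leq_trans (leq_subr _ _) _; rewrite -[leqLHS]muln1 leq_mul // (leq_trans b0).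
  + exact: leq_mul.
  + by apply: leq_trans (leq_div _ _) _; rewrite -[leqLHS]muln1 leq_mul // (leq_trans b0).
  + by apply: leq_trans (leq_mod _ _) _; rewrite -[leqLHS]muln1 leq_mul // (leq_trans b0).
- by apply: leq_trans (inputb _) _; rewrite -{1}(expn1 b) leq_exp2l.
Qed.

Lemma eval_ltn v e : bounded v -> degree e <= D -> eval input v e < 2 ^ w.
Proof.
move=> bv eD; apply: leq_ltn_trans bD; apply: leq_trans (eval_leq e bv) _.
by rewrite leq_exp2l.
Qed.

(** Passing to a right operand raises [t] by one while the degree drops by at least one, so the
    scratch cells stay below [V + D + 2]. Cells below [t] survive, which protects the variables and
    the pending left operand. *)
Lemma code_expr_correct v e t p M o :
  loaded p (code_expr t e) -> V <= t -> t + degree e <= V + D + 2 ->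
  degree e <= D -> wf_expr V e -> bounded v -> agree M v -> fits K w M ->
  exists M', [/\ reach (size (code_expr 0 e)) (Config p M o)
                   (Config (p + size (code_expr 0 e)) M' o),
               forall x, x < t -> M' x = M x & M' t = eval input v e].
Proof.
move=> + + + + + bv.
elim: e t p M => [k | x | f e1 IH1 e2 IH2 | e IH] t p M /= ld Vt tD eD wf aM fM.
- exists (upd M t k); split; last by rewrite upd_eq.
    have := @reach_instr _ _ M o ld fM; rewrite addn1; apply.
    apply: fits_upd => //; first by lia.
    exact: (@eval_ltn _ (Lit k) bv eD).
  by move=> y yt; rewrite !upd_ltn.
- case: (loaded_cons ld) => ld1 ld2.
  have xt : x < t by apply: leq_trans Vt.
  have tK : t < K by lia.
  have f1 : fits K w (upd M t 0) by apply: fits_upd => //; rewrite expn_gt0.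
  exists (upd (upd M t 0) t (M x)); split.
  + rewrite (_ : 2 = 1 + 1) // addnA.
    apply: reach_trans (@reach_instr _ _ _ o ld1 fM f1) _.
    have := @reach_instr p.+1 _ (upd M t 0) o ld2 f1.
    rewrite /= upd_ltn // upd_eq !addn0 !addn1; apply.
    apply: fits_upd => //; rewrite aM //.
    exact: (@eval_ltn _ (Var x) bv eD).
  + by move=> y yt; rewrite !upd_ltn.
  + by rewrite upd_eq aM.
- case: (loaded_cat ld) => ld1 /loaded_cat[ld2 ld3].
  case/andP: wf => wf1 wf2; have d1 := degree_gt0 e1; have d2 := degree_gt0 e2.
  have [||M1 [r1 g1 v1]] := IH1 t p M ld1 Vt _ _ wf1 aM fM; [lia | lia |].
  have f1 := reach_fits r1.
  have a1 : agree M1 v by move=> y yV; rewrite g1 ?aM // (leq_trans yV).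
  rewrite (size_code_expr t 0) in ld2 ld3.
  have [|||M2 [r2 g2 v2]] := IH2 t.+1 _ M1 ld2 _ _ _ wf2 a1 f1; [lia | lia | lia |].
  have f2 := reach_fits r2.
  rewrite (size_code_expr t.+1 0) in ld3.
  set k := eval_arith f (eval input v e1) (eval input v e2).
  exists (upd M2 t k); split; last by rewrite upd_eq.
    rewrite !size_cat (size_code_expr 1 0) !addnA addn1; rewrite -addn1 -addnA.
    apply: reach_trans r1 _; apply: reach_trans r2 _.
    have := @reach_instr _ _ M2 o ld3 f2.
    rewrite /= v2 g2 // v1 addn1; apply.
    apply: fits_upd => //; first by lia.
    exact: (@eval_ltn _ (Op f e1 e2) bv eD).
  by move=> y yt; rewrite upd_ltn // g2 ?g1 // ltnW.
- case: (loaded_cat ld) => ld1 ld2; have d1 := degree_gt0 e.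
  have [||M1 [r1 g1 v1]] := IH t p M ld1 Vt _ _ wf aM fM; [lia | lia |].
  have f1 := reach_fits r1; rewrite (size_code_expr t 0) in ld2.
  exists (upd M1 t (nth 0 input (eval input v e))); split; last by rewrite upd_eq.
    rewrite size_cat /= addnA; apply: reach_trans r1 _.
    have := @reach_instr _ _ M1 o ld2 f1; rewrite /= v1 addn1; apply.
    apply: fits_upd => //; first by lia.
    exact: (@eval_ltn _ (Inp e) bv eD).
  by move=> y yt; rewrite upd_ltn // g1.
Qed.

Lemma bounded_set_nth v x k : bounded v -> k <= b -> bounded (set_nth 0 v x k).
Proof. by move=> bv kb y; rewrite nth_set_nth /=; case: eqP. Qed.

Lemma agree_upd M v x k : agree M v -> agree (upd M x k) (set_nth 0 v x k).
Proof. by move=> aM y yV; rewrite /upd nth_set_nth /=; case: eqP => // _; apply: aM. Qed.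

Lemma code_cmd_correct c p M s s' :
  runs input b c s s' -> loaded p (code_cmd V p c) -> degree_cmd c <= D ->
  wf_cmd V c -> bounded s.1 -> agree M s.1 -> fits K w M ->
  bounded s'.1 /\
  exists M', reach (time_cmd b c) (Config p M s.2)
               (Config (p + size_code c) M' s'.2) /\ agree M' s'.1.
Proof.
elim: c p M s s' => [x e | x | c1 IH1 c2 IH2 | x c IH] p M s s' /=.
- case=> eb -> ld eD /andP[xV wf] bs aM fM /=.
  split; first exact: bounded_set_nth.
  case: (loaded_cat ld) => ld1 /loaded_cons[ld2 ld3].
  rewrite !(size_code_expr V 0) in ld2 ld3.
  have [|M1 [r1 g1 v1]] := code_expr_correct s.2 ld1 (leqnn V) _ eD wf bs aM fM.
    by lia.
  have f1 := reach_fits r1.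
  set k := eval input s.1 e in eb v1 *.
  have f2 : fits K w (upd M1 V.+1 0) by apply: fits_upd; rewrite ?expn_gt0 //; lia.
  have f3 : fits K w (upd (upd M1 V.+1 0) x k).
    apply: fits_upd => //; first by lia.
    exact: (@eval_ltn _ e bs eD).
  exists (upd (upd M1 V.+1 0) x k); split; last first.
    apply: agree_upd => y yV.
    by rewrite upd_ltn ?g1 ?aM // ltnW.
  rewrite addnA; apply: reach_trans r1 _.
  rewrite (_ : 2 = 1 + 1) // addnA.
  apply: reach_trans (@reach_instr _ _ _ s.2 ld2 f1 f2) _.
  have := @reach_instr _ _ (upd M1 V.+1 0) s.2 ld3 f2.
  rewrite /= upd_ltn // v1 upd_eq !addn0 !addn1; exact.
- move=> -> ld _ xV bs aM fM; split=> //=; exists M; split=> //.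
  have := @reach_instr _ _ M s.2 ld fM; rewrite /= aM // addn1; exact.
- case=> s1 [run1 run2] /loaded_cat[ld1 ld2] dD /andP[wf1 wf2] bs aM fM.
  rewrite size_code_cmd in ld2.
  have [|b1 [M1 [r1 a1]]] := IH1 p M s s1 run1 ld1 _ wf1 bs aM fM; first by lia.
  have [|b2' [M2 [r2 a2]]] :=
    IH2 _ M1 s1 s' run2 ld2 _ wf2 b1 a1 (reach_fits r1); first by lia.
  by split=> //; exists M2; split=> //; rewrite addnA; apply: reach_trans r2.
- case=> k [f [f0 fk fx fS]] /loaded_cons[ld1 /loaded_cat[ld2]].
  rewrite size_code_cmd => /loaded_cons[ld3 /loaded_cons[ld4 ld5]].
  move=> dD /andP[xV wf] bs aM fM.
  have kb : k <= b by have := bs x; rewrite -f0 fx // subn0.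
  have VK0 : V < K by lia.
  have one_w : 1 < 2 ^ w.
    by apply: leq_ltn_trans bD; rewrite expn_gt0 (leq_trans _ b2).
  (* Loop invariant: after [i] rounds control is back at the test and the memory agrees with
     [f i]. *)
  suff main i : i <= k -> bounded (f i).1 /\
      exists M', reach (i * (time_cmd b c + 4)) (Config p M s.2)
                       (Config p M' (f i).2) /\ agree M' (f i).1.
    have [] := main k (leqnn k); rewrite fk => bs' [M' [r a]]; split=> //.
    exists M'; split=> //; apply: reach_trans.
      by apply: reach_leq r; rewrite leq_mul2r kb orbT.
    have := @reach_instr _ _ M' s'.2 ld1 (reach_fits r).
    rewrite /= a // -fk fx // subnn eqxx fk; apply; exact: (reach_fits r).
  elim: i => [_ | i IHi ik].
    by rewrite f0; split=> //; exists M; split=> //; apply: reach_refl.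
  have [bi [Mi [ri ai]]] := IHi (ltnW ik).
  have [s1 [run1 ->]] := fS i ik.
  have fi := reach_fits ri.
  have [b1 [M1 [r1 a1]]] := IH p.+1 Mi (f i) s1 run1 ld2 dD wf bi ai fi.
  have f1 := reach_fits r1.
  split; first by apply: bounded_set_nth => //; apply: leq_trans (leq_subr _ _) _.
  set M2 := upd M1 V 1; have f2 : fits K w M2 by apply: fits_upd.
  set M3 := upd M2 x (nth 0 s1.1 x - 1).
  have f3 : fits K w M3.
    apply: fits_upd => //; first by lia.
    apply: leq_ltn_trans (leq_subr _ _) _; apply: leq_ltn_trans (b1 x) _.
    apply: leq_ltn_trans bD; rewrite -{1}(expn1 b) leq_exp2l //; exact: ltnW.
  exists M3; split; last first.
    by apply: agree_upd => y yV; rewrite /M2 upd_ltn // a1.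
  rewrite mulSnr; apply: reach_trans ri _.
  rewrite (_ : _ + 4 = 1 + (time_cmd b c + (1 + (1 + 1)))); last by lia.
  apply: (@reach_trans _ _ _ (Config p.+1 Mi (f i).2)).
    have := @reach_instr _ _ Mi (f i).2 ld1 fi.
    by rewrite /= ai // fx ?(ltnW ik) // subn_eq0 leqNgt ik; apply.
  apply: reach_trans r1 _.
  apply: reach_trans (@reach_instr _ _ _ s1.2 ld3 f1 f2) _.
  apply: (@reach_trans _ _ _ (Config (p.+1 + size_code c).+2 M3 s1.2)).
    have := @reach_instr _ _ M2 s1.2 ld4 f2.
    rewrite /= /M2 upd_eq upd_ltn // a1 //; exact.
  exact: (@reach_instr _ _ M3 s1.2 ld5 f3 f3).
Qed.

End Machine.

(** * The program *)

Lemma runs_asg input b x e c v o y s' :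
  eval input v e = y -> y <= b ->
  runs input b c (set_nth 0 v x y, o) s' ->
  runs input b (Seq (Asg x e) c) (v, o) s'.
Proof. by move=> <- yb run; exists (set_nth 0 v x (eval input v e), o). Qed.

Lemma runs_asg_last input b x e v o y s' :
  eval input v e = y -> y <= b -> s' = (set_nth 0 v x y, o) ->
  runs input b (Asg x e) (v, o) s'.
Proof. by move=> <- yb ->. Qed.

Lemma runs_seq input b c1 c2 s1 s s' :
  runs input b c1 s s1 -> runs input b c2 s1 s' ->
  runs input b (Seq c1 c2) s s'.
Proof. by move=> run1 run2; exists s1. Qed.

(* In [f j i], [j] is the value of the loop counter and [i] the number of
   iterations performed. *)
Arguments runs : simpl never.

Lemma runs_loop input b x c k (f : nat -> nat -> state) s :
  s = f k 0 ->
  (forall j i, nth 0 (f j i).1 x = j) ->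
  (forall j j' i, (set_nth 0 (f j i).1 x j', (f j i).2) = f j' i) ->
  (forall i, i < k -> runs input b c (f (k - i) i) (f (k - i) i.+1)) ->
  runs input b (Loop x c) s (f 0 k).
Proof.
move=> -> fx fset fS; exists k, (fun i => f (k - i) i); split=> //.
- by rewrite subn0.
- by rewrite subnn.
- move=> i ik; exists (f (k - i) i.+1); split; first exact: fS.
  by rewrite /decr fx fset subn1 -subnS.
Qed.

(** Truncated subtraction turns comparisons into the values 0 and 1; in [eqE] the sum of the two
    differences is the distance of the operands. *)
Definition leE (e1 e2 : expr) : expr := Op Defs.Sub (Lit 1) (Op Defs.Sub e1 e2).

Definition eqE (e1 e2 : expr) : expr :=
  Op Defs.Sub (Lit 1) (Op Add (Op Defs.Sub e1 e2) (Op Defs.Sub e2 e1)).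

Lemma sub1_leq x y : 1 - (x - y) = (x <= y).
Proof. case: leqP; lia. Qed.

Lemma sub1_eq x y : 1 - ((x - y) + (y - x)) = (x == y).
Proof. case: eqP; lia. Qed.

Lemma eq_nat_of_bool (x y : bool) : (nat_of_bool x == y) = (x == y).
Proof. by case: x; case: y. Qed.

Declare Scope expr_scope.
Delimit Scope expr_scope with expr.
Bind Scope expr_scope with expr.
Notation "e1 + e2" := (Op Add e1 e2) : expr_scope.
Notation "e1 - e2" := (Op Defs.Sub e1 e2) : expr_scope.
Notation "e1 * e2" := (Op Mul e1 e2) : expr_scope.
Notation "e1 / e2" := (Op Div e1 e2) : expr_scope.
Notation "e1 'mod' e2" := (Op Mod e1 e2) (at level 40) : expr_scope.
Coercion Lit : nat >-> expr.
Arguments Asg x e%_expr.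
Arguments Inp e%_expr.
Arguments leE (e1 e2)%_expr.
Arguments eqE (e1 e2)%_expr.

Declare Scope cmd_scope.
Delimit Scope cmd_scope with cmd.
Bind Scope cmd_scope with cmd.
Notation "x <~ e" := (Asg x e) (at level 60) : cmd_scope.
Notation "c1 ;; c2" := (Seq c1 c2) (at level 61, right associativity) : cmd_scope.

Notation seedctr := 0.
Notation bestseed := 1.
Notation bestcnt := 2.
Notation seed := 3.
Notation satcnt := 4.
Notation pos := 5.
Notation clauses := 6.
Notation lits := 7.
Notation satlits := 8.
Notation lit := 9.
Notation poscnt := 10.
Notation negcnt := 11.
Notation pos' := 12.
Notation clauses' := 13.
Notation lits' := 14.
Notation allpos := 15.
Notation allneg := 16.
Notation digits := 17.
Notation bits := 18.
Notation value := 19.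
Local Notation "$ x" := (Var x) (at level 1, format "$ x").

Section Algorithm.

Variables N theta : nat.

(** Seed digits and bits of [2i+1] are consumed in lockstep, where [$lit / 2] is the index i. The
    sum accumulates in [value], which is 0 on entry; resetting work variables to 0 keeps the states
    between commands explicit. *)
Definition hash_cmd : cmd :=
 (digits <~ $seed;;
  bits <~ 2 * ($lit / 2) + 1;;
  lits' <~ Inp 0 + 1;;
  Loop lits'
    (value <~ $value + ($bits mod 2) * ($digits mod N);;
     bits <~ $bits / 2;;
     digits <~ $digits / N);;
  value <~ leE ($value mod N + 1) theta;;
  digits <~ 0;;
  bits <~ 0)%cmd.

(* Empty clauses are counted on both sides, which does not affect the comparison. *)
Definition majority_cmd : cmd :=
 (pos' <~ 2;;
  clauses' <~ Inp 1;;
  Loop clauses'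
    (lits' <~ Inp $pos';;
     pos' <~ $pos' + 1;;
     allpos <~ 1;;
     allneg <~ 1;;
     Loop lits'
       (allpos <~ $allpos * eqE (Inp $pos') (2 * ($lit / 2) + 1);;
        allneg <~ $allneg * eqE (Inp $pos') (2 * ($lit / 2));;
        pos' <~ $pos' + 1);;
     poscnt <~ $poscnt + $allpos;;
     negcnt <~ $negcnt + $allneg;;
     allpos <~ 0;;
     allneg <~ 0);;
  value <~ eqE $value (leE $negcnt $poscnt);;
  poscnt <~ 0;;
  negcnt <~ 0;;
  pos' <~ 0)%cmd.

Definition bit_cmd : cmd := Seq hash_cmd majority_cmd.

Definition literal_cmd : cmd :=
 (lit <~ Inp $pos;;
  pos <~ $pos + 1;;
  bit_cmd;;
  satlits <~ $satlits + eqE $value ($lit mod 2);;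
  value <~ 0;;
  lit <~ 0)%cmd.

Definition clause_cmd : cmd :=
 (lits <~ Inp $pos;;
  pos <~ $pos + 1;;
  Loop lits literal_cmd;;
  satcnt <~ $satcnt + leE 1 $satlits;;
  satlits <~ 0)%cmd.

(** The counter runs down to 1, hence the seed is the counter minus one. The best pair is updated
    without branching, with [satlits] reused as a 0/1 flag. *)
Definition seed_cmd : cmd :=
 (seed <~ $seedctr - 1;;
  pos <~ 2;;
  clauses <~ Inp 1;;
  Loop clauses clause_cmd;;
  satlits <~ leE ($bestcnt + 1) $satcnt;;
  bestseed <~ $bestseed * (1 - $satlits) + $seed * $satlits;;
  bestcnt <~ $bestcnt * (1 - $satlits) + $satcnt * $satlits;;
  satlits <~ 0;;
  satcnt <~ 0;;
  pos <~ 0;;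
  seed <~ 0)%cmd.

Definition square (e : expr) : expr := Op Mul e e.

(** Five squarings give [(n + 2) ^ 32]. In the output loop [clauses] counts down from [n], so
    [Inp 0 - $clauses] runs upwards and the bits come out in order. *)
Definition maxsat_cmd : cmd :=
 (seedctr <~ square (square (square (square (square (Inp 0 + 2)))));;
  Loop seedctr seed_cmd;;
  seed <~ $bestseed;;
  clauses <~ Inp 0;;
  Loop clauses
    (lit <~ 2 * (Inp 0 - $clauses);;
     bit_cmd;;
     Out value;;
     value <~ 0;;
     lit <~ 0))%cmd.

Definition words (G : seq (seq nat)) : seq nat :=
  flatten [seq size g :: g | g <- G].

(** * The functions that the program computes *)

Variables (n : nat) (G : seq (seq nat)).

Definition input := n :: size G :: words G.

(** For [N <= 2 ^ 10] the sample space has at most [(n + 2) ^ 30] seeds; 32 is the next exponent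
    reachable by squaring. *)
Definition num_seeds := (n + 2) ^ 32.

(** The address of the length word of clause [i]; the 2 skips [n] and the number of clauses. *)
Definition offset i := 2 + size (words (take i G)).

Definition hash S i := \sum_(t < n.+1)
  (i.*2.+1 %/ 2 ^ t) %% 2 * ((S %/ N ^ t) %% N).

(** The comparison of counts is the preferred value, with ties going to true; the hash test keeps it
    on success and flips it on failure. *)
Definition bit S i : bool := (hash S i %% N < theta) ==
  (count (all (pred1 i.*2)) G <= count (all (pred1 i.*2.+1)) G).

Definition score S := count (has (fun l => bit S l./2 == odd l)) G.

(** The registers [bestseed] and [bestcnt] after [i] rounds, which have tried the seeds from [M - 1]
    down to [M - i]. *)
Fixpoint best M i : nat * nat :=
  if i is i'.+1 then
    if (best M i').2 < score (M - i) then (M - i, score (M - i)) else best M i'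
  else (0, 0).

Lemma best_spec M i S : i <= M -> M - i <= S < M -> score S <= score (best M i).1.
Proof.
(* The initial pair [(0, 0)] may understate the score of seed 0, so the recorded count is only shown
   to lie between the scores seen and the score of the recorded seed. *)
suff [H1 H2] : (best M i).2 <= score (best M i).1 /\
    (i <= M -> M - i <= S < M -> score S <= (best M i).2).
  by move=> iM iS; apply: leq_trans (H2 iM iS) _.
elim: i => [|i [IH1 IH2]] /=; first by split=> // _; rewrite subn0 ltnNge andbN.
case: ltnP => [lt | ge]; split=> // iM iS.
all: case: (ltngtP S (M - i.+1)) => [|ltS|->] //; first by move: iS; lia.
  by apply: leq_trans (ltnW lt); apply: IH2; lia.
by apply: IH2; lia.
Qed.

Lemma best_lt M i : 0 < M -> (best M i).1 < M.
Proof.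
by move=> M0; elim: i => //= i IH; case: ifP => //= _; rewrite ltn_subrL.
Qed.

Lemma best_score M i : (best M i).2 <= size G.
Proof. by elim: i => //= i IH; case: ifP => // _; apply: count_size. Qed.

Lemma words_split i : i < size G ->
  words G = words (take i G) ++ size (nth [::] G i) :: nth [::] G i ++ words (drop i.+1 G).
Proof.
move=> iG; rewrite -{1}(cat_take_drop i G) (drop_nth [::]) //.
by rewrite /words map_cat flatten_cat /= .
Qed.

Lemma offsetS i : i < size G -> offset i.+1 = offset i + 1 + size (nth [::] G i).
Proof.
move=> iG; rewrite /offset (take_nth [::]) // /words map_rcons flatten_rcons.
by rewrite size_cat /=; lia.
Qed.

Lemma nth_input_size i : i < size G -> nth 0 input (offset i) = size (nth [::] G i).
Proof. by move=> iG; rewrite /input /offset /= (words_split iG) nth_cat ltnn subnn. Qed.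

Lemma nth_input_lit i t : i < size G -> t < size (nth [::] G i) ->
  nth 0 input (offset i + 1 + t) = nth 0 (nth [::] G i) t.
Proof.
move=> iG ti; rewrite /input /offset -!addnA /= (words_split iG) nth_cat.
by rewrite add0n ltnNge leq_addr addKn add1n /= nth_cat ti.
Qed.

Lemma leq_offset i : i < size G -> offset i + 1 + size (nth [::] G i) <= size input.
Proof.
move=> iG; rewrite /offset /input /= (words_split iG) !size_cat /= size_cat; lia.
Qed.

Lemma nth_input0 : nth 0 input 0 = n.
Proof. by []. Qed.

Lemma nth_input1 : nth 0 input 1 = size G.
Proof. by []. Qed.

Lemma offset0 : offset 0 = 2.
Proof. by rewrite /offset take0. Qed.

(* Otherwise simplification unfolds [nth 0 input (offset i)]. *)
Local Opaque input offset.

(** * Correctness of the program, from one bit up to the whole search *)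

Variable b : nat.
Hypotheses (N2 : 2 <= N) (Nb : N * (n + 2) <= b) (seedb : num_seeds <= b).
Hypothesis inputb : forall x, nth 0 input x <= b.
Hypothesis sizeb : size input <= b.
Hypothesis litb : forall i t, nth 0 (nth [::] G i) t <= 2 * n.

Lemma leq_n_b : 2 * (n + 2) <= b.
Proof. by apply: leq_trans Nb; rewrite leq_mul2r N2 orbT. Qed.

Lemma size_G_b : size G <= b.
Proof. by rewrite -nth_input1. Qed.

Lemma bool_b (x : bool) : x <= b.
Proof. by have := leq_n_b; case: x; lia. Qed.

Section Bit.

Variables (s bs bc sd ct p j k q l : nat) (o : seq bool).
Hypotheses (sdb : sd <= b) (lb : l <= 2 * n).

Let frame (w : seq nat) : state :=
  ([:: s, bs, bc, sd, ct, p, j, k, q, l & w], o).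

Lemma hash_correct :
  runs input b hash_cmd (frame (nseq 10 0))
    (frame [:: 0; 0; 0; 0; 0; 0; 0; 0; 0; nat_of_bool (hash sd l./2 %% N < theta)]).
Proof.
have nb := leq_n_b; have half_l := odd_double_half l; rewrite /frame /hash_cmd /=.
apply: (@runs_asg _ _ _ _ _ _ _ sd) => //=.
apply: (@runs_asg _ _ _ _ _ _ _ l./2.*2.+1) => /=.
- by rewrite divn2 mul2n addn1.
- lia.
apply: (@runs_asg _ _ _ _ _ _ _ n.+1) => /=; [by rewrite nth_input0 addn1 | lia |].
pose h t := \sum_(i < t) (l./2.*2.+1 %/ 2 ^ i) %% 2 * ((sd %/ N ^ i) %% N).
pose f c t := frame [:: 0; 0; 0; 0; c; 0; 0; sd %/ N ^ t; l./2.*2.+1 %/ 2 ^ t; h t].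
apply: (@runs_seq _ _ _ _ (f 0 n.+1)).
  apply: runs_loop => // [|t tn]; rewrite /f /frame /=.
    by rewrite /h !expn0 !divn1 big_ord0.
  (* Each of the at most [n + 1] terms is at most [N], so [N * (n + 2)] bounds all partial sums. *)
  have hb : h t.+1 <= b.
    apply: leq_trans Nb; apply: (@leq_trans (\sum_(i < t.+1) N)).
      apply: leq_sum => i _; rewrite modn2 -[leqRHS]mul1n leq_mul ?leq_b1 //.
      by apply: ltnW; rewrite ltn_pmod // ltnW.
    by rewrite sum_nat_const card_ord mulnC leq_mul2l; lia.
  apply: (@runs_asg _ _ _ _ _ _ _ (h t.+1)) => //=; first by rewrite /h big_ord_recr.
  apply: (@runs_asg _ _ _ _ _ _ _ (l./2.*2.+1 %/ 2 ^ t.+1)) => /=.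
  - by rewrite -divnMA expnSr.
  - by apply: leq_trans (leq_div _ _) _; lia.
  apply: (@runs_asg_last _ _ _ _ _ _ (sd %/ N ^ t.+1)) => //=.
  - by rewrite -divnMA expnSr.
  - exact: leq_trans (leq_div _ _) _.
rewrite /f /frame.
apply: (@runs_asg _ _ _ _ _ _ _ (nat_of_bool (h n.+1 %% N < theta))) => /=.
- by rewrite sub1_leq addn1.
- exact: bool_b.
apply: (@runs_asg _ _ _ _ _ _ _ 0) => //=.
Qed.

Lemma majority_correct (y : bool) :
  runs input b majority_cmd (frame [:: 0; 0; 0; 0; 0; 0; 0; 0; 0; nat_of_bool y])
    (frame [:: 0; 0; 0; 0; 0; 0; 0; 0; 0; nat_of_bool
       (y == (count (all (pred1 l./2.*2)) G <= count (all (pred1 l./2.*2.+1)) G))]).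
Proof.
have nb := leq_n_b; have Gb := size_G_b; rewrite /frame /majority_cmd /=.
have l2 : 2 * (l %/ 2) = l./2.*2 by rewrite divn2 mul2n.
apply: (@runs_asg _ _ _ _ _ _ _ 2) => //=; first by lia.
apply: (@runs_asg _ _ _ _ _ _ _ (size G)) => //=.
pose ct1 i := count (all (pred1 l./2.*2.+1)) (take i G).
pose ct0 i := count (all (pred1 l./2.*2)) (take i G).
have ct1b i : ct1 i <= b.
  by apply: leq_trans (count_size _ _) (leq_trans (size_subseq (take_subseq _ _)) Gb).
have ct0b i : ct0 i <= b.
  by apply: leq_trans (count_size _ _) (leq_trans (size_subseq (take_subseq _ _)) Gb).
pose f c i := frame [:: ct1 i; ct0 i; offset i; c; 0; 0; 0; 0; 0; nat_of_bool y].
apply: (@runs_seq _ _ _ _ (f 0 (size G))).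
  apply: runs_loop => // [|i iG]; rewrite /f /frame /=.
    by rewrite /ct1 /ct0 take0 offset0.
  have offb := leq_trans (leq_offset iG) sizeb.
  set g := nth [::] G i in offb *.
  apply: (@runs_asg _ _ _ _ _ _ _ (size g)) => /=.
  - by rewrite nth_input_size.
  - lia.
  apply: (@runs_asg _ _ _ _ _ _ _ (offset i + 1)) => //=; first by lia.
  apply: (@runs_asg _ _ _ _ _ _ _ 1) => //=; first by lia.
  apply: (@runs_asg _ _ _ _ _ _ _ 1) => //=; first by lia.
  pose al x t := all (pred1 x) (take t g).
  pose f' c t := frame [:: ct1 i; ct0 i; offset i + 1 + t; size G - i; c;
    nat_of_bool (al l./2.*2.+1 t); nat_of_bool (al l./2.*2 t); 0; 0; nat_of_bool y].
  apply: (@runs_seq _ _ _ _ (f' 0 (size g))).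
    apply: runs_loop => // [|t tg]; rewrite /f' /frame /=.
      by rewrite /al take0 addn0.
    have alS x : al x t * (nth 0 g t == x) = al x t.+1.
      by rewrite /al (take_nth 0) // all_rcons /= mulnb andbC.
    apply: (@runs_asg _ _ _ _ _ _ _ (al l./2.*2.+1 t.+1)) => /=.
    - by rewrite sub1_eq nth_input_lit // l2 addn1 alS.
    - exact: bool_b.
    apply: (@runs_asg _ _ _ _ _ _ _ (al l./2.*2 t.+1)) => /=.
    - by rewrite sub1_eq nth_input_lit // l2 alS.
    - exact: bool_b.
    apply: (@runs_asg_last _ _ _ _ _ _ (offset i + 1 + t.+1)) => //=; lia.
  rewrite /f' /frame /al take_size -offsetS //.
  have ctS x : count (all (pred1 x)) (take i G) + all (pred1 x) g =
      count (all (pred1 x)) (take i.+1 G).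
    by rewrite (take_nth [::]) // -cats1 count_cat /= addn0.
  apply: (@runs_asg _ _ _ _ _ _ _ (ct1 i.+1)) => //=; first exact: ctS.
  apply: (@runs_asg _ _ _ _ _ _ _ (ct0 i.+1)) => //=; first exact: ctS.
  apply: (@runs_asg _ _ _ _ _ _ _ 0) => //=.
rewrite /f /frame /ct1 /ct0 take_size.
apply: (@runs_asg _ _ _ _ _ _ _ (nat_of_bool
    (y == (count (all (pred1 l./2.*2)) G <= count (all (pred1 l./2.*2.+1)) G)))) => /=.
- by rewrite sub1_leq sub1_eq eq_nat_of_bool.
- exact: bool_b.
apply: (@runs_asg _ _ _ _ _ _ _ 0) => //=.
apply: (@runs_asg _ _ _ _ _ _ _ 0) => //=.
Qed.

Lemma bit_correct :
  runs input b bit_cmd (frame (nseq 10 0))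
    (frame [:: 0; 0; 0; 0; 0; 0; 0; 0; 0; nat_of_bool (bit sd l./2)]).
Proof. exact: runs_seq hash_correct (majority_correct _). Qed.

End Bit.

Lemma literal_correct s bs bc sd ct j k q i t o :
  sd <= b -> q < b -> i < size G -> t < size (nth [::] G i) ->
  let l := nth 0 (nth [::] G i) t in
  runs input b literal_cmd
    ([:: s, bs, bc, sd, ct, offset i + 1 + t, j, k, q, 0 & nseq 10 0], o)
    ([:: s, bs, bc, sd, ct, offset i + 1 + t.+1, j, k,
         q + (bit sd l./2 == odd l), 0 & nseq 10 0], o).
Proof.
move=> sdb qb iG tg l; have nb := leq_n_b.
have offb := leq_trans (leq_offset iG) sizeb.
have lb : l <= 2 * n := litb _ _.
apply: (@runs_asg _ _ _ _ _ _ _ l) => /=; [exact: nth_input_lit | lia |].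
apply: (@runs_asg _ _ _ _ _ _ _ (offset i + 1 + t.+1)) => /=; [lia | lia |].
apply: runs_seq; first exact: bit_correct.
apply: (@runs_asg _ _ _ _ _ _ _ (q + (bit sd l./2 == odd l))) => /=.
- by rewrite sub1_eq modn2 eq_nat_of_bool.
- by case: eqP => _; lia.
by apply: (@runs_asg _ _ _ _ _ _ _ 0).
Qed.

Lemma clause_correct s bs bc sd ct j i o :
  sd <= b -> ct < b -> i < size G ->
  runs input b clause_cmd
    ([:: s, bs, bc, sd, ct, offset i, j, 0, 0, 0 & nseq 10 0], o)
    ([:: s, bs, bc, sd, ct + has (fun l => bit sd l./2 == odd l) (nth [::] G i),
         offset i.+1, j, 0, 0, 0 & nseq 10 0], o).
Proof.
move=> sdb ctb iG; have offb := leq_trans (leq_offset iG) sizeb.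
set g := nth [::] G i in offb *.
apply: (@runs_asg _ _ _ _ _ _ _ (size g)) => /=; [exact: nth_input_size | lia |].
apply: (@runs_asg _ _ _ _ _ _ _ (offset i + 1)) => //=; first by lia.
pose q t := count (fun l => bit sd l./2 == odd l) (take t g).
pose f c t : state :=
  ([:: s, bs, bc, sd, ct, offset i + 1 + t, j, c, q t, 0 & nseq 10 0], o).
apply: (@runs_seq _ _ _ _ (f 0 (size g))).
  apply: runs_loop => // [|t tg]; first by rewrite /f /q take0 addn0.
  rewrite /f; have -> : q t.+1 = q t + (bit sd (nth 0 g t)./2 == odd (nth 0 g t)).
    by rewrite /q (take_nth 0) // -cats1 count_cat /= addn0.
  apply: literal_correct => //; apply: (@leq_ltn_trans t); last by lia.
  by apply: leq_trans (count_size _ _) _; rewrite size_take; case: ifP; lia.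
rewrite /f /q take_size -offsetS //.
apply: (@runs_asg _ _ _ _ _ _ _ (ct + has (fun l => bit sd l./2 == odd l) g)) => /=.
- by rewrite sub1_leq has_count.
- by case: has; lia.
by [].
Qed.

Lemma seed_correct s bs bc o : s < b -> bs <= b -> bc <= b ->
  let r := if bc < score s then (s, score s) else (bs, bc) in
  runs input b seed_cmd ([:: s.+1, bs, bc & nseq 17 0], o)
    ([:: s.+1, r.1, r.2 & nseq 17 0], o).
Proof.
move=> sb bsb bcb r; have Gb := size_G_b; have nb := leq_n_b.
apply: (@runs_asg _ _ _ _ _ _ _ s) => /=; [by rewrite subn1 | lia |].
apply: (@runs_asg _ _ _ _ _ _ _ (offset 0)) => /=;
  [by rewrite offset0 | rewrite offset0; lia |].
apply: (@runs_asg _ _ _ _ _ _ _ (size G)) => //=.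
pose sc i := count (has (fun l => bit s l./2 == odd l)) (take i G).
pose f c i : state :=
  ([:: s.+1, bs, bc, s, sc i, offset i, c, 0, 0, 0 & nseq 10 0], o).
apply: (@runs_seq _ _ _ _ (f 0 (size G))).
  apply: runs_loop => // [|i iG]; first by rewrite /f /sc take0.
  rewrite /f; have -> : sc i.+1 = sc i + has (fun l => bit s l./2 == odd l) (nth [::] G i).
    by rewrite /sc (take_nth [::]) // -cats1 count_cat /= addn0.
  apply: clause_correct; rewrite ?(ltnW sb) //.
  apply: (@leq_ltn_trans i); last by lia.
  by apply: leq_trans (count_size _ _) _; rewrite size_take; case: ifP; lia.
have scoreb : score s <= b by apply: leq_trans (count_size _ _) _.
rewrite /f /sc take_size -/(score s).
apply: (@runs_asg _ _ _ _ _ _ _ (nat_of_bool (bc < score s))) => /=.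
- by rewrite sub1_leq addn1.
- exact: bool_b.
apply: (@runs_asg _ _ _ _ _ _ _ r.1) => /=.
- by rewrite /r; case: ltnP; rewrite /= ?muln0 ?muln1 ?addn0.
- by rewrite /r; case: ltnP => //= _; lia.
apply: (@runs_asg _ _ _ _ _ _ _ r.2) => /=.
- by rewrite /r; case: ltnP; rewrite /= ?muln0 ?muln1 ?addn0.
- by rewrite /r; case: ltnP => //= _; lia.
by do 3!apply: (@runs_asg _ _ _ _ _ _ _ 0) => //=.
Qed.

Lemma maxsat_correct :
  let S := (best num_seeds num_seeds).1 in
  exists v, runs input b maxsat_cmd (nseq 20 0, [::])
    (v, [seq bit S i | i <- iota 0 n]).
Proof.
set M := num_seeds => S; have nb := leq_n_b; have Gb := size_G_b.
have M0 : 0 < M by rewrite expn_gt0 addn_gt0 orbT.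
exists [:: 0, S, (best M M).2, S & nseq 16 0].
apply: (@runs_asg _ _ _ _ _ _ _ M) => //=.
  by rewrite nth_input0 !mulnn -!expnM.
pose f c i : state := ([:: c, (best M i).1, (best M i).2 & nseq 17 0], [::]).
apply: (@runs_seq _ _ _ _ (f 0 M)).
  apply: runs_loop => // i iM; rewrite /f.
  (* In round [i] the counter is [M - i], the successor of the seed [M - i.+1]. *)
  have := @seed_correct (M - i.+1) (best M i).1 (best M i).2 [::].
  rewrite /= -(surjective_pairing (best M i)) -subSn // subSS; apply.
  - by lia.
  - by apply: ltnW; apply: leq_trans (best_lt i M0) _.
  - exact: leq_trans (best_score _ _) _.
rewrite /f -/S.
have Sb : S <= b by apply: ltnW; apply: leq_trans (best_lt M M0) _.
apply: (@runs_asg _ _ _ _ _ _ _ S) => //=.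
apply: (@runs_asg _ _ _ _ _ _ _ n) => //=; first by lia.
pose h c i : state :=
  ([:: 0, S, (best M M).2, S, 0, 0, c & nseq 13 0], [seq bit S i | i <- iota 0 i]).
apply: (@runs_loop _ _ _ _ n h) => // i lin; rewrite /h.
have -> : [seq bit S i | i <- iota 0 i.+1] = rcons [seq bit S i | i <- iota 0 i] (bit S i).
  by rewrite -addn1 iotaD map_cat cats1.
apply: (@runs_asg _ _ _ _ _ _ _ i.*2) => /=; [by rewrite nth_input0; lia | lia |].
apply: runs_seq; first by apply: bit_correct => //; lia.
apply: (@runs_seq _ _ _ _ (_, rcons _ _)); first by [].
rewrite doubleK /=.
by apply: (@runs_asg _ _ _ _ _ _ _ 0) => //=; rewrite eqb0 negbK.
Qed.

End Algorithm.

(** * The golden ratio bound *)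

(* Averaging over the translates of [A]: since [h] is onto, translating [A]
   amounts to reindexing [E], so all translates have equally many preimages. *)
Lemma card_preim_additive (E : finZmodType) (W : finType) (op : W -> W -> W)
    (h : E -> W) (A : pred W) :
  (forall w, injective (op w)) ->
  (forall x y, h (x + y)%R = op (h x) (h y)) -> (forall w, exists x, h x = w) ->
  #|[set x | A (h x)]| * #|W| = #|E| * #|A|.
Proof.
move=> opI hD hS; rewrite -sum1dep_card big_mkcond /= mulnC -sum_nat_const.
transitivity (\sum_(w : W) \sum_(x : E) (A (op (h x) w) : nat)).
  apply: eq_bigr => w _; have [u hu] := hS w.
  rewrite (reindex_inj (addIr u)) /=; apply: eq_bigr => x _.
  by rewrite hD hu; case: (A _).
rewrite exchange_big /= -sum_nat_const; apply: eq_bigr => x _.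
rewrite -sum1_card [RHS]big_mkcond [RHS](reindex_inj (opI (h x))) /=.
by apply: eq_bigr => w _; rewrite unfold_in; case: (A _).
Qed.

Section GoldenRatio.

Variables (E : finType) (n N theta : nat) (a : E -> assignment n).
Variables (w : 'I_n -> bool) (F : formula n).

(* [prob i b / N] is the probability that [x_i = b]. *)
Definition prob (i : 'I_n) (b : bool) := if b == w i then theta else N - theta.

(** A clause may repeat its literal and still be a unit clause. Empty clauses are neither unit nor
    long. *)
Definition unit_clause (l : literal n) (C : clause n) : bool :=
  (C != [::]) && all (pred1 l) C.

Definition long_clause (C : clause n) : bool :=
  if C is l :: C' then ~~ all (pred1 l) C' else false.

Hypotheses (N0 : 0 < N) (thetaN : theta <= N) (half_theta : N <= theta + theta).
(* Writing p = theta / N, this is p <= 1 - p ^ 2. *)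
Hypothesis golden : theta * theta + theta * N <= N * N.
Hypothesis prob1 : forall i b,
  #|[set e | a e i == b]| * N = #|E| * prob i b.
Hypothesis prob2 : forall i j b b', i != j ->
  #|[set e | (a e i == b) && (a e j == b')]| * (N * N) =
  #|E| * (prob i b * prob j b').
Hypothesis majority : forall i,
  count (unit_clause (i, ~~ w i)) F <= count (unit_clause (i, w i)) F.

Lemma prob_leq i b : prob i b <= theta.
Proof. by rewrite /prob; case: ifP => // _; lia. Qed.

(** Two distinct literals on one variable are complementary, so the clause always holds. Otherwise
    failure falsifies both, and pairwise independence applies. *)
Lemma long_clause_prob (C : clause n) :
  long_clause C -> #|E| * theta <= #|[set e | sat_clause (a e) C]| * N.
Proof.
case: C => //= l1 C' /allPn[l2 l2C' l12].
set C := l1 :: C'.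
have [eq1|neq1] := eqVneq l1.1 l2.1.
  have -> : [set e | sat_clause (a e) C] = setT.
    apply/setP => e; rewrite !inE; apply/hasP.
    case: (eqVneq (a e l1.1) l1.2) => [e1|ne1].
      by exists l1; rewrite ?mem_head ?e1.
    exists l2; first by rewrite inE l2C' orbT.
    move: l12 ne1; rewrite -eq1 /= => l12 ne1.
    have : l2.2 != l1.2.
      apply: contra l12 => /eqP e2; apply/eqP.
      by rewrite (surjective_pairing l1) (surjective_pairing l2) eq1 e2.
    by case: (l2.2) ne1; case: (l1.2); case: (a e _).
  by rewrite cardsT leq_mul.
rewrite -(leq_pmul2r N0).
set X := [set e | sat_clause (a e) C].
set Y := [set e | (a e l1.1 == ~~ l1.2) && (a e l2.1 == ~~ l2.2)].
have XY : #|E| <= #|X| + #|Y|.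
  rewrite -(cardsC X) leq_add2l subset_leq_card //; apply/subsetP => e.
  rewrite !inE => /hasPn ns.
  have := ns l1 (mem_head _ _); have := ns l2; rewrite inE l2C' orbT => /(_ isT).
  by case: (a e l1.1); case: (a e l2.1); case: (l1.2); case: (l2.2).
have := prob2 (~~ l1.2) (~~ l2.2) neq1; rewrite -/Y => pY.
have ppt : prob l1.1 (~~ l1.2) * prob l2.1 (~~ l2.2) <= theta * theta.
  by rewrite leq_mul ?prob_leq.
(* Adding the size of [Y], known from [prob2], to both sides reduces the goal to [golden]. *)
rewrite -(leq_add2r (#|Y| * (N * N))) {1}pY -mulnA -[X in _ <= X + _]mulnA.
rewrite -mulnDl -mulnDr; apply: leq_trans (leq_mul XY (leqnn _)).
by rewrite leq_mul2l; apply/orP; right; lia.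
Qed.

(** At most one term on the left is nonzero. A unit clause holds exactly when its literal does, so
    [prob1] gives equality; a long clause falls under [long_clause_prob]. *)
Lemma clause_prob (C : clause n) :
  #|E| * (theta * long_clause C + \sum_l unit_clause l C * prob l.1 l.2) <=
  #|[set e | sat_clause (a e) C]| * N.
Proof.
case: C => [|l C]; first by rewrite big1 // muln0 muln0.
have unitE l' : unit_clause l' (l :: C) = (l == l') && all (pred1 l') C by [].
have [uC|nuC] := boolP (all (pred1 l) C).
  rewrite /long_clause uC muln0 add0n (bigD1 l) //= unitE uC eqxx mul1n.
  rewrite big1 => [|l' nl]; last by rewrite unitE eq_sym (negbTE nl).
  rewrite addn0 -prob1 leq_mul2r; apply/orP; right; apply: eq_leq; apply: eq_card => e.
  rewrite !inE /sat_clause /=.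
  case: eqP => //= ne; apply/esym/hasPn => l' /(allP uC)/eqP->.
  by apply/eqP.
have lC : long_clause (l :: C) by [].
rewrite big1 => [|l' _]; last first.
  by rewrite unitE; case: eqP => //= <-; rewrite (negbTE nuC).
by rewrite lC muln1 addn0 long_clause_prob.
Qed.

(** A satisfied clause that is not long consists of copies of one literal, and [al] makes that
    literal true. *)
Lemma clause_sat_leq (al : assignment n) (C : clause n) :
  sat_clause al C <= long_clause C + \sum_i unit_clause (i, al i) C.
Proof.
case: C => // l C; case sat: sat_clause => //.
have [lC|] := boolP (long_clause (l :: C)); first exact: leq_addr.
rewrite /= negbK => uC; rewrite add0n.
have el : al l.1 = l.2.
  by case/hasP: sat => l1; rewrite in_cons => /orP[/eqP->|/(allP uC)/eqP->] /eqP.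
rewrite (bigD1 l.1) //= el -surjective_pairing /unit_clause /= eqxx uC.
by rewrite leq_addr.
Qed.

Lemma average_num_sat (al : assignment n) :
  #|E| * (theta * num_sat F al) <= N * \sum_e num_sat F (a e).
Proof.
have countE (p : pred (clause n)) : count p F = \sum_(C <- F) p C.
  by rewrite -sum1_count big_mkcond; apply: eq_bigr => C _; case: (p C).
have -> : \sum_e num_sat F (a e) = \sum_(C <- F) #|[set e | sat_clause (a e) C]|.
  rewrite (eq_bigr (fun e => \sum_(C <- F) sat_clause (a e) C)); last first.
    by move=> e _; exact: countE.
  rewrite exchange_big; apply: eq_bigr => C _ /=.
  by rewrite -sum1dep_card [RHS]big_mkcond; apply: eq_bigr => e _; case: sat_clause.
rewrite big_distrr /=.
apply: (@leq_trans (\sum_(C <- F) #|E| *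
    (theta * long_clause C + \sum_l unit_clause l C * prob l.1 l.2))); last first.
  by apply: leq_sum => C _; rewrite [leqRHS]mulnC; exact: clause_prob.
rewrite -big_distrr leq_mul2l big_split -big_distrr /=; apply/orP; right.
rewrite exchange_big /=.
rewrite (eq_bigr (fun l => count (unit_clause l) F * prob l.1 l.2)); last first.
  by move=> l _; rewrite -big_distrl countE.
apply: (@leq_trans (theta * (\sum_(C <- F) long_clause C +
    \sum_i count (unit_clause (i, al i)) F))).
  rewrite leq_mul2l /num_sat countE; apply/orP; right.
  rewrite (eq_bigr (fun i => \sum_(C <- F) unit_clause (i, al i) C)); last first.
    by move=> i _; exact: countE.
  rewrite exchange_big -big_split /=; apply: leq_sum => C _; exact: clause_sat_leq.
rewrite mulnDr leq_add2l big_distrr /=.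
rewrite -(pair_bigA _ (fun i b => count (unit_clause (i, b)) F * prob i b)) /=.
(* The preferred group alone contributes [theta] times the larger count, whichever value [al]
   picks. *)
apply: leq_sum => i _; rewrite big_bool /=; have := majority i; rewrite /prob.
by case: (w i); case: (al i) => /=; nia.
Qed.

Lemma exists_approx (al : assignment n) : 0 < #|E| ->
  exists e, theta * num_sat F al <= N * num_sat F (a e).
Proof.
move=> E0; apply/existsP; apply: contraT => /existsPn lt; move: (average_num_sat al).
rewrite leqNgt big_distrr /= -sum_nat_const.
have /card_gt0P[e0 _] := E0.
(* One term split off supplies the strict inequality; the others need only the weak one. *)
rewrite (bigD1 e0) // [X in _ < X](bigD1 e0) //= -addSn.
have lt' e : N * num_sat F (a e) < theta * num_sat F al by rewrite ltnNge lt.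
by rewrite leq_add //; apply: leq_sum => e _; apply: ltnW.
Qed.

End GoldenRatio.

(** * Pairwise independent bits *)

Definition of_digits (N L : nat) (d : nat -> nat) : nat := \sum_(t < L) d t * N ^ t.

Lemma of_digitsS N L d :
  of_digits N L.+1 d = of_digits N L (fun t => d t.+1) * N + d 0.
Proof.
rewrite /of_digits big_ord_recl muln1 addnC big_distrl; congr (_ + _).
by apply: eq_bigr => t _ /=; rewrite -mulnA -expnSr.
Qed.

Lemma of_digits_ltn N L d : (forall t, d t < N) -> of_digits N L d < N ^ L.
Proof.
elim: L d => [|L IH] d dN; first by rewrite /of_digits big_ord0.
by rewrite of_digitsS expnSr; have := IH _ (fun t => dN t.+1); have := dN 0; nia.
Qed.

Lemma nth_digit N L d t : (forall t, d t < N) -> t < L ->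
  (of_digits N L d %/ N ^ t) %% N = d t.
Proof.
move=> dN; have N0 : 0 < N by apply: leq_ltn_trans (dN 0).
elim: L t d dN => // L IH [|t] d dN tL; rewrite of_digitsS.
  by rewrite divn1 modnMDl modn_small.
by rewrite expnS divnMA divnMDl // [d 0 %/ N]divn_small // addn0 IH.
Qed.

Lemma eq_bits L x y : x < 2 ^ L -> y < 2 ^ L ->
  (forall t, t < L -> odd (x %/ 2 ^ t) = odd (y %/ 2 ^ t)) -> x = y.
Proof.
elim: L x y => [|L IH] x y; first by case: x y => [|//] [].
rewrite expnSr -!ltn_divLR // => xL yL xy.
rewrite (divn_eq x 2) (divn_eq y 2) !modn2; congr (_ * _ + _).
  by apply: IH => // t tL; have := xy t.+1 tL; rewrite expnS !divnMA.
by have := xy 0 isT; rewrite !divn1 => ->.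
Qed.

Section Seeds.

Variables (N k : nat).
Hypothesis N1 : 1 < N.

Local Notation seed_space := 'rV['Z_N]_k.+1.

(** The hash with values in ['Z_N], where it is additive in the seed, as [card_preim_additive]
    requires. *)
Definition hashZ (i : nat) (s : seed_space) : 'Z_N :=
  (\sum_(t < k.+1) (odd (i.*2.+1 %/ 2 ^ t))%:R * s 0 t)%R.

Definition seed_of (s : seed_space) : nat :=
  of_digits N k.+1 (fun t => s 0%R (inord t)).

Lemma hashZD i s s' : hashZ i (s + s')%R = (hashZ i s + hashZ i s')%R.
Proof. by rewrite -big_split; apply: eq_bigr => t _; rewrite mxE mulrDr. Qed.

Definition single (t : 'I_k.+1) (x : 'Z_N) : seed_space :=
  (\row_u (if u == t then x else 0))%R.

Lemma hashZ_single i t x :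
  hashZ i (single t x) = ((odd (i.*2.+1 %/ 2 ^ t))%:R * x)%R.
Proof.
rewrite /hashZ (bigD1 t) //= big1 => [|u ut]; first by rewrite mxE eqxx addr0.
by rewrite mxE (negbTE ut) mulr0.
Qed.

(** Bit 0 of [2i+1] is always 1, so digit 0 alone makes every hash onto, even for i = 0. *)
Lemma hashZ_single0 i x : hashZ i (single ord0 x) = x.
Proof. by rewrite hashZ_single divn1 /= odd_double mul1r. Qed.

(** Take a position [t] where the two expansions differ. Digit 0 shifts both hashes alike and digit
    [t] only the one whose bit is set, so together they reach every pair. With 0/1 coefficients this
    also works for composite [N]. *)
Lemma hashZ_pair_surj i j (x y : 'Z_N) :
  i.*2.+1 < 2 ^ k.+1 -> j.*2.+1 < 2 ^ k.+1 -> i != j ->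
  exists s, (hashZ i s, hashZ j s) = (x, y).
Proof.
move=> ik jk ij.
have [t tij] : exists t : 'I_k.+1,
    odd (i.*2.+1 %/ 2 ^ t) != odd (j.*2.+1 %/ 2 ^ t).
  apply/existsP; apply: contraT => /existsPn eqij.
  suff /eqP : i.*2.+1 = j.*2.+1 by rewrite eqSS -!muln2 eqn_pmul2r // (negbTE ij).
  apply: eq_bits ik jk _ => t tk; apply/eqP.
  by have := eqij (Ordinal tk); rewrite negbK.
case: (boolP (odd (i.*2.+1 %/ 2 ^ t))) tij => oi; rewrite eq_sym ?eqb_id => oj.
  exists (single ord0 y + single t (x - y))%R.
  rewrite !hashZD !hashZ_single0 !hashZ_single oi (negbTE oj).
  by rewrite mul1r mul0r addr0 addrC subrK.
exists (single ord0 x + single t (y - x))%R.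
rewrite !hashZD !hashZ_single0 !hashZ_single (negbTE oi).
move: oj; rewrite eqbF_neg negbK => ->.
by rewrite mul1r mul0r addr0 [(x + (y - x))%R]addrC subrK.
Qed.

(** The program sums over [n.+1] positions; those beyond [k] contribute 0, since [2i+1] has no bits
    there. *)
Lemma hash_seed_of n i s : i.*2.+1 < 2 ^ k.+1 -> k <= n ->
  hash N n (seed_of s) i %% N = hashZ i s.
Proof.
move=> ik kn; rewrite -val_Zp_nat //; congr nat_of_ord.
have dN t : s 0%R (inord t) < N by rewrite -[X in _ < X](Zp_cast N1) ltn_ord.
rewrite /hash -(big_mkord xpredT
  (fun t => (i.*2.+1 %/ 2 ^ t) %% 2 * ((seed_of s %/ N ^ t) %% N))).
rewrite (@big_cat_nat _ _ _ k.+1) //= [X in _ + X]big_nat_cond [X in _ + X]big1; last first.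
  move=> t /andP[/andP[kt _] _]; rewrite divn_small ?mod0n //.
  by apply: leq_trans ik _; rewrite leq_exp2l.
rewrite addn0 big_mkord natr_sum; apply: eq_bigr => t _.
by rewrite natrM modn2 nth_digit // inord_val natr_Zp.
Qed.

Lemma card_Z : #|'Z_N| = N.
Proof. by rewrite card_ord Zp_cast. Qed.

Lemma card_hashZ i (A : pred 'Z_N) :
  #|[set s | A (hashZ i s)]| * N = #|{: seed_space}| * #|A|.
Proof.
have := @card_preim_additive seed_space 'Z_N +%R (hashZ i) A (@addrI _) (hashZD i).
rewrite card_Z; apply=> x; exists (single ord0 x); exact: hashZ_single0.
Qed.

Lemma card_hashZ2 i j (A B : pred 'Z_N) :
  i.*2.+1 < 2 ^ k.+1 -> j.*2.+1 < 2 ^ k.+1 -> i != j ->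
  #|[set s | A (hashZ i s) && B (hashZ j s)]| * (N * N) =
  #|{: seed_space}| * (#|A| * #|B|).
Proof.
move=> ik jk ij.
have <- : #|[pred z : 'Z_N * 'Z_N | A z.1 && B z.2]| = #|A| * #|B|.
  by rewrite -cardX; apply: eq_card.
have <- : #|{: 'Z_N * 'Z_N}| = N * N by rewrite card_prod card_Z.
apply: (@card_preim_additive seed_space ('Z_N * 'Z_N)%type (fun p q => p + q)%R
          (fun s => (hashZ i s, hashZ j s))
          (fun z => A z.1 && B z.2)).
- exact: addrI.
- by move=> s s'; rewrite !hashZD.
- by case=> x y; apply: hashZ_pair_surj.
Qed.

End Seeds.

(** * Approximation and complexity *)

Lemma card_ord_ltn m t : t <= m -> #|[pred z : 'I_m | z < t]| = t.
Proof.
move=> tm; rewrite -sum1_card -[RHS]card_ord -[RHS]sum1_card.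
by rewrite (big_ord_widen m (fun=> 1)).
Qed.

Definition literals n (F : formula n) : seq (seq nat) :=
  [seq map (@encode_literal n) C | C <- F].

Lemma encode_input n (F : formula n) : encode F = input n (literals F).
Proof.
rewrite /encode /input /words /literals size_map -map_comp.
by congr [:: _, _ & flatten _]; apply: eq_map => C; rewrite /= size_map.
Qed.

Lemma encode_literalE n (l : literal n) : encode_literal l = l.2 + l.1.*2.
Proof. by rewrite /encode_literal mul2n addnC. Qed.

Lemma count_all_literals n (F : formula n) (i : 'I_n) (b : bool) :
  count (all (pred1 (b + i.*2))) (literals F) =
  count (all (pred1 (i, b))) F.
Proof.
rewrite count_map; apply: eq_count => C /=; rewrite all_map.
apply: eq_all => -[j c] /=; rewrite encode_literalE /= xpair_eqE.
apply/eqP/andP => [e | [/eqP-> /eqP->] //]; split.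
  have := congr1 half e; rewrite !half_bit_double => ij.
  by apply/eqP/val_inj.
by have := congr1 odd e; rewrite !oddD !odd_double !addbF !oddb => ->.
Qed.

Lemma count_all_unit n (F : formula n) (l : literal n) :
  count (all (pred1 l)) F = count (unit_clause l) F + count (pred1 [::]) F.
Proof. by elim: F => //= -[|l' C] F -> /=; rewrite /unit_clause /=; lia. Qed.

Section Approximation.

Variables (N theta n : nat) (F : formula n).

Definition seed_assignment (S : nat) : assignment n :=
  [ffun i : 'I_n => bit N theta n (literals F) S i].

Lemma score_num_sat S :
  score N theta n (literals F) S = num_sat F (seed_assignment S).
Proof.
rewrite /score count_map; apply: eq_count => C /=; rewrite has_map.
apply: eq_has => l /=; rewrite encode_literalE half_bit_double ffunE.
by rewrite oddD odd_double addbF oddb.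
Qed.

Hypotheses (N1 : 1 < N) (N10 : N <= 2 ^ 10).
Hypotheses (thetaN : theta <= N) (half_theta : N <= theta + theta).
Hypothesis golden : theta * theta + theta * N <= N * N.

Let w (i : 'I_n) : bool :=
  count (all (pred1 i.*2)) (literals F) <= count (all (pred1 i.*2.+1)) (literals F).

Lemma majority_unit_clause i :
  count (unit_clause (i, ~~ w i)) F <= count (unit_clause (i, w i)) F.
Proof.
rewrite -(leq_add2r (count (pred1 [::]) F)) -!count_all_unit -!count_all_literals.
by case wi: (w i) => //=; apply: ltnW; rewrite ltnNge -/(w i) wi.
Qed.

(** [k.+1] is the bit length of [2n+1]: enough digits for every index, and few enough that
    [N ^ k.+1] stays polynomial in [n]. *)
Let k := trunc_log 2 n.*2.+1.

Let bits_k (i : 'I_n) : i.*2.+1 < 2 ^ k.+1.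
Proof.
apply: leq_ltn_trans (trunc_log_ltn _ _) => //.
by rewrite ltnS leq_double ltnW.
Qed.

Let leq_k_n : k <= n.
Proof.
rewrite -ltnS -(@ltn_exp2l 2) //; apply: leq_ltn_trans (trunc_logP _ _) _ => //.
by rewrite expnS mul2n -doubleS leq_double ltn_expl.
Qed.

Lemma leq_num_seeds : N ^ k.+1 <= num_seeds n.
Proof.
have n2 : 2 <= n + 2 by rewrite leq_addl.
have k2 : 2 ^ k <= (n + 2) ^ 2.
  apply: leq_trans (trunc_logP _ _) _ => //; lia.
apply: (@leq_trans ((2 ^ 10) ^ k.+1)); first by rewrite leq_exp2r.
rewrite expnS expnAC.
apply: (@leq_trans ((n + 2) ^ 10 * ((n + 2) ^ 2) ^ 10)).
  by rewrite leq_mul // leq_exp2r.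
by rewrite -expnM -expnD leq_exp2l.
Qed.

Lemma best_seed_approx (al : assignment n) :
  let M := num_seeds n in
  theta * num_sat F al <=
  N * num_sat F (seed_assignment (best N theta n (literals F) M M).1).
Proof.
set M := num_seeds n => /=.
pose a (s : 'rV['Z_N]_k.+1) := seed_assignment (seed_of s).
pose A i b := [pred z : 'Z_N | ((z < theta) == w i) == b].
have aA s i b : (a s i == b) = A i b (hashZ i s).
  by rewrite /a ffunE /bit (hash_seed_of N1 s (bits_k i) leq_k_n).
have cardA i b : #|A i b| = prob N theta w i b.
  have Zc : #|[pred z : 'Z_N | z < theta]| = theta.
    by apply: card_ord_ltn; rewrite Zp_cast.
  have Zc' : #|[predC [pred z : 'Z_N | z < theta]]| = N - theta.
    by apply/eqP; rewrite -(eqn_add2l theta) -{1}Zc cardC card_Z // subnKC.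
  rewrite /prob; case: eqP => [-> | /eqP bw].
    by rewrite -[RHS]Zc; apply: eq_card => z; rewrite !inE; case: (z < _); case: (w i).
  rewrite -[RHS]Zc'; apply: eq_card => z; rewrite !inE; move: bw.
  by case: (z < _); case: (w i); case: b.
have p1 i b : #|[set s | a s i == b]| * N = #|{: 'rV['Z_N]_k.+1}| * prob N theta w i b.
  rewrite -cardA -(card_hashZ k N1 i (A i b)); congr (_ * _); apply: eq_card => s.
  by rewrite !inE aA.
have p2 (i j : 'I_n) b b' : i != j ->
    #|[set s | (a s i == b) && (a s j == b')]| * (N * N) =
    #|{: 'rV['Z_N]_k.+1}| * (prob N theta w i b * prob N theta w j b').
  move=> ij; rewrite -!cardA -(card_hashZ2 N1 _ _ (bits_k i) (bits_k j)) //.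
  by congr (_ * _); apply: eq_card => s; rewrite !inE !aA.
have E0 : 0 < #|{: 'rV['Z_N]_k.+1}| by apply/card_gt0P; exists 0%R.
have [s le] := exists_approx (ltnW N1) thetaN half_theta golden p1 p2
  majority_unit_clause al E0.
apply: leq_trans le _; rewrite leq_mul2l -!score_num_sat; apply/orP; right.
(* The good seed is a number below [N ^ k.+1], hence among those tried. *)
apply: best_spec => //; rewrite subnn /=; apply: leq_trans leq_num_seeds.
apply: of_digits_ltn => t; by rewrite -[X in _ < X](Zp_cast N1) ltn_ord.
Qed.

End Approximation.

(** * Resource bounds and conclusion *)

Lemma size_words_leq r (G : seq (seq nat)) :
  all (fun g => size g <= r) G -> size (words G) <= size G * r.+1.
Proof.
elim: G => //= g G IH /andP[gr Gr]; rewrite size_cat mulSn addSn ltnS.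
by rewrite leq_add // IH.
Qed.

Lemma approx_optimal_frac p q n (F : formula n) (a : assignment n) : 0 < q ->
  p * max_sat F <= q * num_sat F a -> approx_optimal (p%:R / q%:R)%R F a.
Proof.
move=> q0 le; rewrite /approx_optimal mulrAC ler_pdivrMr ?ltr0n //.
by rewrite -!natrM ler_nat [leqRHS]mulnC.
Qed.

(** The program is chosen before [d], which only affects the exponent [c]. By [size_uniq_instance],
    formulas without repeated clauses are covered by [d = 2 * r]. *)
Theorem theorem1 (r : nat) :
  exists P : program, forall d : nat, exists c : nat,
    forall (n : nat) (F : formula n),
      max_rsat_instance r F -> size F <= (n + 2) ^ d ->
      exists a : assignment n,
        computes P (encode F) ((n + 2) ^ c) (c * trunc_log 2 (n + 2))
          (encode_assignment a)
        /\ approx_optimal (618 / 1000)%R F a.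
Proof.
pose C := maxsat_cmd 1000 618.
(* The added 2 secures [2 <= D]; the memory has 20 variable cells and [D + 2] scratch cells. *)
pose D := degree_cmd C + 2; pose K := 20 + D + 2.
have [e1 timeC] := time_cmd_poly C.
exists (code_cmd 20 0 C) => d.
(* [(n + 2) ^ e0] bounds the input words, the input length, the number of seeds and
   [1000 * (n + 2)]. The summands of [c] pay for time and for [K] words. *)
pose e0 := d + r + 40; pose c := e0 * e1 + K * (2 * (e0 * D)).
exists c => n F rF sF.
set M := num_seeds n; set S := (best 1000 618 n (literals F) M M).1.
exists (seed_assignment 1000 618 F S); split; last first.
  apply: approx_optimal_frac => //; have [al ->] : {al | max_sat F = num_sat F al}.
    by apply: eq_bigmax; rewrite card_ffun card_bool expn_gt0.
  (* Here [golden] reads 618 * 618 + 618 * 1000 = 999924 <= 1000000. *)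
  apply: best_seed_approx; lia.
pose b := (n + 2) ^ e0.
have n2 : 2 <= n + 2 by rewrite leq_addl.
have leq_b x e : x <= (n + 2) ^ e -> e <= e0 -> x <= b.
  by move=> xe ee; apply: leq_trans xe _; rewrite leq_exp2l.
have nb : 2 * n <= b by apply: (leq_b _ 2) => //; [nia | rewrite /e0; lia].
have leq_r x : x <= r.+1 -> x <= (n + 2) ^ r.
  by move=> xr; apply: leq_trans xr _; apply: leq_trans (ltn_expl r n2) _.
have mb : size F <= b by apply: leq_b sF _; rewrite /e0; lia.
have litb g t : g \in literals F -> nth 0 g t <= 2 * n.
  case/mapP => Cl _ ->; have [tC|Ct] := ltnP t (size (map (@encode_literal n) Cl)).
    have /mapP[l _ ->] := mem_nth 0 tC.
    by rewrite encode_literalE; have := ltn_ord l.1; case: (l.2) => /=; lia.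
  by rewrite nth_default.
have sizeG : all (fun g => size g <= r) (literals F).
  by rewrite all_map; apply: sub_all rF => Cl; rewrite /= size_map.
have inputb x : nth 0 (encode F) x <= b.
  have [xF|Fx] := ltnP x (size (encode F)); last by rewrite nth_default.
  have := mem_nth 0 xF; rewrite encode_input !inE => /or3P[/eqP->|/eqP->|].
  - by apply: leq_trans nb; lia.
  - by rewrite size_map.
  - case/flattenP => _ /mapP[g gG ->]; rewrite inE => /orP[/eqP->|yg].
      apply: (leq_b _ r); last by rewrite /e0; lia.
      by apply: leq_r; apply: leqW; apply: (allP sizeG).
    by rewrite -(nth_index 0 yg); apply: leq_trans nb; apply: litb.
have sizeb : size (encode F) <= b.
  rewrite encode_input /=; apply: (leq_b _ (d + r + 2)); last by rewrite /e0; lia.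
  have : size (words (literals F)) <= (n + 2) ^ (d + r).
    apply: leq_trans (size_words_leq sizeG) _.
    by rewrite size_map expnD leq_mul // leq_r.
  rewrite (expnD _ (d + r) 2); have : 0 < (n + 2) ^ (d + r) by rewrite expn_gt0 addn2.
  by move: (size _) ((n + 2) ^ (d + r)) => x y; nia.
have seedb : num_seeds n <= b by rewrite leq_exp2l // /e0; lia.
have Nb : 1000 * (n + 2) <= b.
  apply: (leq_b _ 11); last by rewrite /e0; lia.
  by rewrite expnSr leq_mul // (@leq_trans (2 ^ 10)) // leq_exp2r.
rewrite encode_input in inputb sizeb *.
have litb' i t : nth 0 (nth [::] (literals F) i) t <= 2 * n.
  have [iG|Gi] := ltnP i (size (literals F)); first by rewrite litb ?mem_nth.
  by rewrite (nth_default [::]) ?nth_nil.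
have [v run_v] := maxsat_correct 618 (isT : 1 < 1000) Nb seedb inputb sizeb litb'.
have b2 : 2 <= b by apply: (leq_b _ 1) => //; rewrite ?expn1 // /e0; lia.
pose l := trunc_log 2 (n + 2); pose w := l * (2 * (e0 * D)).
(* Since [l >= 1], [n + 2 < 2 ^ (l + 1) <= 2 ^ (2 * l)], so a word length proportional to [l]
   suffices. *)
have bD : b ^ D < 2 ^ w.
  have -> : 2 ^ w = (2 ^ (2 * l)) ^ (e0 * D) by rewrite -expnM /w mulnCA mulnA.
  rewrite /b -expnM ltn_exp2r; last by rewrite muln_gt0 /e0 /D; lia.
  apply: leq_trans (trunc_log_ltn (n + 2) (isT : 1 < 2)) _.
  by rewrite leq_exp2l // mul2n -addnn -add1n leq_add2r trunc_log_gt0.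
have [|||||||_ [M' [[t [tT et ft]] _]]] := @code_cmd_correct (code_cmd 20 0 C)
    (input n (literals F)) K w b D 20 b2 inputb bD (leqnn _) _ C 0 (fun=> 0)
    (nseq 20 0, [::]) _ run_v.
- by rewrite /D addn2.
- by exists [::], [::]; rewrite cats0.
- exact: leq_addr.
- by [].
- by move=> x; rewrite nth_nseq if_same.
- by move=> x _; rewrite nth_nseq if_same.
- by move=> x; rewrite expn_gt0; case: ifP.
rewrite add0n in et; exists t, K, w; split=> //.
- apply: leq_trans tT _; apply: leq_trans (timeC b b2) _.
  by rewrite /b -expnM leq_exp2l // leq_addr.
- by rewrite /run et /halted size_code_cmd.
- rewrite /run et /=; rewrite /encode_assignment -val_enum_ord -map_comp.
  by apply: eq_map => i /=; rewrite ffunE.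
- by rewrite /w mulnCA mulnC leq_mul2r leq_addl orbT.
Qed.
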